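(* Let $\mathcal{G}=(\mathcal{V},\mathcal{E})$ be a graph and $\{\Gamma_v: v\in\mathcal{V}\}$ a family of nontrivial (discrete) groups. Let $\Gamma$ be the graph product of $\{\Gamma_v:v\in\mathcal{V}\}$ with respect to $\mathcal{G}$, and for $U\subseteq\mathcal{V}$ let $\Gamma_U\le\Gamma$ be the graph product of $\{\Gamma_v:v\in U\}$ with respect to the induced subgraph $\mathcal{G}|_U$. Then for $V_1,V_2\subseteq\mathcal{V}$, $\Gamma_{V_1}$ is amenable relative to $\Gamma_{V_2}$ inside $\Gamma$ if and only if both of the following hold: (1) $\Gamma_v$ is amenable for each $v\in V_1\setminus V_2$; (2) for each $v\in V_1\setminus V_2$ and $w\in V_1$ with $v\neq w$, either $(v,w)\in\mathcal{E}$, or both of the following hold: (a) $\Gamma_v\cong\Gamma_w\cong\mathbb{Z}/2\mathbb{Z}$; (b) $v$ and $w$ are adjacent to all vertices in $V_1\setminus\{v,w\}$.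
   Context: Graphs are finite and simple: $\mathcal{V}$ is a finite set, $\mathcal{E}\subseteq\mathcal{V}\times\mathcal{V}$ is symmetric, and $(u,u)\notin\mathcal{E}$ for all $u$; $v,w$ are adjacent if $(v,w)\in\mathcal{E}$. The induced subgraph $\mathcal{G}|_U$ has vertex set $U$ and edge set $\mathcal{E}\cap(U\times U)$. The graph product $\Gamma$ is the quotient of the free product of the groups $\Gamma_v$ by the relations that $\Gamma_v$ and $\Gamma_w$ commute whenever $(v,w)\in\mathcal{E}$; $\Gamma_U$ is naturally identified with the subgroup of $\Gamma$ generated by $\{\Gamma_v:v\in U\}$ ($\Gamma_\varnothing$ trivial). For subgroups $\Lambda_1,\Lambda_2\le\Gamma$, $\Lambda_1$ is amenable relative to $\Lambda_2$ inside $\Gamma$ if there is a $\Lambda_1$-invariant mean on $\Gamma/\Lambda_2$ (a state on $\ell^\infty(\Gamma/\Lambda_2)$ invariant under left translation by $\Lambda_1$); equivalently, $L(\Lambda_1)$ is amenable relative to $L(\Lambda_2)$ inside $L(\Gamma)$, i.e. there is a conditional expectation $\langle L(\Gamma),e_{L(\Lambda_2)}\rangle\to L(\Lambda_1)$ from the basic construction whose restriction to $L(\Gamma)$ is normal. *)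

(* Defs.v *)
From HB Require Import structures.
From mathcomp Require Import all_boot all_order all_algebra.
From mathcomp Require Import boolp classical_sets reals.
From mathcomp Require Import complex.

Set Implicit Arguments.
Unset Strict Implicit.
Unset Printing Implicit Defensive.

Import Order.TTheory GRing.Theory Num.Theory.

Local Open Scope classical_set_scope.
Local Open Scope ring_scope.
Local Open Scope group_scope.

Section GraphProduct.
Variables (V : finType) (e : rel V) (G : V -> groupType).

Definition gp_word := seq {v : V & G v}.

Definition syl (v : V) (x : G v) : {v : V & G v} := Tagged G x.

(* [gpr_unit] and [gpr_mul] present the free product of the [G v]; [gpr_comm]
   adds the commutation of [G v] and [G w] along the edges. *)
Inductive gp_rel : gp_word -> gp_word -> Prop :=
| gpr_refl s : gp_rel s s
| gpr_sym s t : gp_rel s t -> gp_rel t s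
| gpr_trans s t u : gp_rel s t -> gp_rel t u -> gp_rel s u
| gpr_cat s s' t t' : gp_rel s s' -> gp_rel t t' -> gp_rel (s ++ t) (s' ++ t')
| gpr_unit v : gp_rel [:: syl (1 : G v)] [::]
| gpr_mul v (x y : G v) : gp_rel [:: syl x; syl y] [:: syl (x * y)]
| gpr_comm v w (x : G v) (y : G w) : e v w ->
    gp_rel [:: syl x; syl y] [:: syl y; syl x].

Definition gp_eqb (s t : gp_word) : bool := `[< gp_rel s t >].

Lemma gp_eqb_equiv : equiv_class_of gp_eqb.
Proof.
split=> [s|s t|t s u]; rewrite /gp_eqb.
- exact/asboolP/gpr_refl.
- by apply/asboolP/asboolP => /gpr_sym.
- by move=> /asboolP st /asboolP tu; apply/asboolP; apply: gpr_trans tu.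
Qed.
Canonical gp_eqb_rel := EquivRelPack gp_eqb_equiv.

Definition graph_product : Type := {eq_quot gp_eqb}%qT.
HB.instance Definition _ := Choice.on graph_product.
HB.instance Definition _ := EqQuotient.on graph_product.

Definition gp_pi (s : gp_word) : graph_product := (\pi_graph_product s)%qT.

Lemma gp_piP s t : gp_pi s = gp_pi t <-> gp_rel s t.
Proof.
split; first by move=> /eqmodP /asboolP.
by move=> st; apply/eqmodP/asboolP.
Qed.

Lemma gp_repr (x : graph_product) : exists s, x = gp_pi s.
Proof. by exists (repr x); rewrite /gp_pi reprK. Qed.

Definition winv (s : gp_word) : gp_word :=
  rev [seq syl ((tagged i : G (tag i))^-1) | i <- s].

Lemma winv_cat s t : winv (s ++ t) = winv t ++ winv s.
Proof. by rewrite /winv map_cat rev_cat. Qed.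

Lemma gp_rel_winv s t : gp_rel s t -> gp_rel (winv s) (winv t).
Proof.
elim=> {s t}.
- by move=> s; exact: gpr_refl.
- by move=> s t _; exact: gpr_sym.
- by move=> s t u _ st _; exact: gpr_trans.
- by move=> s s' t t' _ ss _ tt; rewrite !winv_cat; exact: gpr_cat.
- by move=> v; rewrite /winv /= invg1; exact: gpr_unit.
- by move=> v x y; rewrite /winv /= invgM; exact: gpr_mul.
- by move=> v w x y evw; rewrite /winv /=; exact/gpr_sym/gpr_comm.
Qed.

Lemma gp_rel_mulV s : gp_rel (winv s ++ s) [::].
Proof.
elim: s => [|[v x] s IHs]; first exact: gpr_refl.
rewrite -cat1s winv_cat -catA (catA (winv [:: _])).
apply: gpr_trans IHs; apply: gpr_cat; first exact: gpr_refl.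
rewrite -[X in gp_rel _ X]cat0s; apply: gpr_cat; last exact: gpr_refl.
by apply: gpr_trans (gpr_mul _ _) _; rewrite mulVg; exact: gpr_unit.
Qed.

Lemma winvK : involutive winv.
Proof.
move=> s; rewrite /winv map_rev revK -map_comp -[RHS]map_id.
by apply: eq_map => -[v x] /=; rewrite invgK.
Qed.

Definition gp_mul (x y : graph_product) := gp_pi (repr x ++ repr y).
Definition gp_inv (x : graph_product) := gp_pi (winv (repr x)).

Lemma gp_rel_repr s : gp_rel (repr (gp_pi s)) s.
Proof. by apply/gp_piP; rewrite /gp_pi reprK. Qed.

Lemma gp_mulE s t : gp_mul (gp_pi s) (gp_pi t) = gp_pi (s ++ t).
Proof. by apply/gp_piP/gpr_cat; exact: gp_rel_repr. Qed.

Lemma gp_invE s : gp_inv (gp_pi s) = gp_pi (winv s).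
Proof. by apply/gp_piP/gp_rel_winv; exact: gp_rel_repr. Qed.

Fact gp_mulA : associative gp_mul.
Proof.
move=> x y z; case: (gp_repr x) (gp_repr y) (gp_repr z) => [s ->] [t ->] [u ->].
by rewrite !gp_mulE catA.
Qed.

Fact gp_mul1 : left_id (gp_pi [::]) gp_mul.
Proof. by move=> x; case: (gp_repr x) => s ->; rewrite gp_mulE. Qed.

Fact gp_mulr1 : right_id (gp_pi [::]) gp_mul.
Proof. by move=> x; case: (gp_repr x) => s ->; rewrite gp_mulE cats0. Qed.

Fact gp_mulV : left_inverse (gp_pi [::]) gp_inv gp_mul.
Proof.
move=> x; case: (gp_repr x) => s ->; rewrite gp_invE gp_mulE.
exact/gp_piP/gp_rel_mulV.
Qed.

Fact gp_mulrV : right_inverse (gp_pi [::]) gp_inv gp_mul.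
Proof.
move=> x; case: (gp_repr x) => s ->; rewrite gp_invE gp_mulE.
by apply/gp_piP; rewrite -{1}[s]winvK; exact: gp_rel_mulV.
Qed.

HB.instance Definition _ := isGroup.Build graph_product
  gp_mulA gp_mul1 gp_mulr1 gp_mulV gp_mulrV.

Definition gp_of (v : V) (x : G v) : graph_product := gp_pi [:: syl x].

Lemma gp_ofM v : {morph @gp_of v : x y / x * y}.
Proof.
by move=> x y; rewrite /gp_of [RHS]gp_mulE; exact/gp_piP/gpr_sym/gpr_mul.
Qed.
HB.instance Definition _ v :=
  isMultiplicative.Build (G v) graph_product (@gp_of v) (@gp_ofM v).

Lemma gp_of_comm v w (x : G v) (y : G w) :
  e v w -> commute (gp_of x) (gp_of y).
Proof.
move=> evw; rewrite /commute /gp_of [LHS]gp_mulE [RHS]gp_mulE.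
exact/gp_piP/gpr_comm.
Qed.

Lemma gp_ind (P : graph_product -> Prop) :
  P 1 -> (forall v (x : G v) y, P y -> P (gp_of x * y)) -> forall x, P x.
Proof.
move=> P1 PM x; case: (gp_repr x) => s ->.
elim: s => [|[v y] s IHs] //.
by have := PM v y _ IHs; rewrite /gp_of [_ * _]gp_mulE.
Qed.

(* Universal property. *)
Lemma gp_lift (H : groupType) (f : forall v, {multiplicative G v -> H}) :
    (forall v w x y, e v w -> commute (f v x) (f w y)) ->
  exists! F : graph_product -> H,
    {morph F : x y / x * y} /\ forall v x, F (gp_of x) = f v x.
Proof.
move=> fC.
pose ev (s : gp_word) : H := \prod_(i <- s) f (tag i) (tagged i).
have evcat s t : ev (s ++ t) = ev s * ev t by rewrite /ev big_cat.
have f1 v : f v 1 = 1.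
  by apply: (@mulgI _ (f v 1)); rewrite -gmulfM !mulg1.
have evP s t : gp_rel s t -> ev s = ev t.
  elim=> {s t} //.
  - by move=> s t u _ -> _ ->.
  - by move=> s s' t t' _ IHs _ IHt; rewrite !evcat IHs IHt.
  - by move=> v; rewrite /ev big_seq1 big_nil /= f1.
  - by move=> v x y; rewrite /ev big_cons !big_seq1 /= gmulfM.
  - by move=> v w x y evw; rewrite /ev !big_cons !big_nil /= !mulg1; apply: fC.
pose F (x : graph_product) := ev (repr x).
have FE s : F (gp_pi s) = ev s by apply: evP; exact: gp_rel_repr.
exists F; split; first split.
- move=> x y; case: (gp_repr x) (gp_repr y) => [s ->] [t ->].
  by rewrite [_ * _ in LHS]gp_mulE !FE evcat.
- by move=> v x; rewrite FE /ev big_seq1.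
move=> F' [F'M F'E]; apply/funext; elim/gp_ind => [|v x y IHy].
  rewrite FE /ev big_nil; apply: (@mulgI _ (F' 1)).
  by rewrite -F'M !mulg1.
rewrite F'M F'E -IHy; case: (gp_repr y) => s ->.
by rewrite /gp_of [_ * _ in LHS]gp_mulE !FE -cat1s evcat /ev big_seq1.
Qed.

End GraphProduct.

Definition is_subgroup (G : groupType) (H : set G) : Prop :=
  H 1 /\ forall x y, H x -> H y -> H (x / y).

(* The subgroup generated by the [G v] with [v \in U]. By [gp_subE] below, it
   is the injective image of the graph product over the subgraph induced on
   [U]. *)
Definition gp_sub (V : finType) (e : rel V) (G : V -> groupType)
    (U : {set V}) : set (graph_product e G) :=
  smallest (@is_subgroup _) (\bigcup_(v in [set` U]) range (@gp_of V e G v)).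
Arguments gp_sub {V} e G U.

Section InducedSubgraph.
Variables (V : finType) (e : rel V) (G : V -> groupType) (U : {set V}).

Definition ind_edge : rel {v | v \in U} := relpre val e.
Definition ind_fam (u : {v | v \in U}) : groupType := G (val u).

Let GU := graph_product ind_edge ind_fam.

Definition ind_incl (u : {v | v \in U}) (x : ind_fam u) :
  graph_product e G := @gp_of V e G (val u) x.

Fact ind_inclM u : {morph @ind_incl u : x y / x * y}.
Proof. by move=> x y; rewrite /ind_incl gp_ofM. Qed.
HB.instance Definition _ u := isMultiplicative.Build _ _ _ (@ind_inclM u).

Definition ind_proj (v : V) (x : G v) : GU :=
  match boolP (v \in U) with
  | AltTrue vU => gp_of ind_edge (x : ind_fam (exist _ v vU))
  | AltFalse _ => 1
  end.

Fact ind_projM v : {morph @ind_proj v : x y / x * y}.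
Proof.
move=> x y; rewrite /ind_proj; case: {-}_ / boolP => vU.
  exact: (@gp_ofM _ ind_edge ind_fam (exist _ v vU)).
by rewrite mulg1.
Qed.
HB.instance Definition _ v := isMultiplicative.Build _ _ _ (@ind_projM v).

Lemma ind_projE u (x : ind_fam u) :
  ind_proj (x : G (val u)) = gp_of ind_edge x.
Proof.
rewrite /ind_proj; case: u x => v vU x /=; case: {-}_ / boolP => [vU'|]; last first.
  by rewrite vU.
by rewrite (bool_irrelevance vU' vU).
Qed.

Lemma gp_subE : exists F : GU -> graph_product e G,
  [/\ {morph F : x y / x * y},
      forall u (x : ind_fam u), F (gp_of ind_edge x) = gp_of e (x : G (val u)),
      injective F & range F = gp_sub e G U].
Proof.
have [|F [[FM FE] _]] := @gp_lift _ ind_edge ind_fam (graph_product e G) ind_incl.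
  by move=> v w x y evw; exact: gp_of_comm.
have [|P [[PM PE] _]] := @gp_lift _ e G GU ind_proj.
  move=> v w x y evw; rewrite /= /ind_proj.
  case: {-}_ / boolP => vU; case: {-}_ / boolP => wU.
  - exact: gp_of_comm.
  - exact: commute1.
  - exact/commute_sym/commute1.
  - exact: commute1.
have F1 : F 1 = 1 by apply: (@mulgI _ (F 1)); rewrite -FM !mulg1.
have P1 : P 1 = 1 by apply: (@mulgI _ (P 1)); rewrite -PM !mulg1.
have FK : cancel F P.
  elim/gp_ind => [|v x y IHy]; first by rewrite F1 P1.
  by rewrite FM PM IHy FE PE /= /ind_incl ind_projE.
exists F; split => //; first exact: can_inj FK.
have FV x : F x^-1 = (F x)^-1.
  by apply: (@mulgI _ (F x)); rewrite -FM !mulgV F1.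
apply/seteqP; split.
  move=> _ [x _ <-] H [[H1 HF] HS].
  have HM y z : H y -> H z -> H (y * z).
    move=> Hy Hz; rewrite -[z]invgK; apply: (HF) => //.
    by rewrite -[z^-1]mul1g; exact: HF.
  elim/gp_ind: x => [|u x y IHy]; first by rewrite F1.
  rewrite FM FE; apply: HM => //; apply: HS.
  by exists (val u); [exact: (valP u) | exists (x : G (val u))].
apply: smallest_sub.
  split; first by exists 1.
  by move=> _ _ [x _ <-] [y _ <-]; exists (x / y); rewrite ?FM ?FV.
move=> _ [v /= vU [x _ <-]].
exists (gp_of ind_edge (x : ind_fam (exist _ v vU))) => //.
Qed.

End InducedSubgraph.

Section Amenability.
Variable R : realType.

Section State.
Variable X : Type.

Definition bounded_fct (f : X -> R[i]) : Prop :=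
  exists M : R[i], forall x, (`|f x| <= M)%R.

(* A state on l^oo(X); only the values of [m] at bounded functions matter.
   In the order of [R[i]], [0 <= z] says that [z] is real and nonnegative. *)
Record is_state (m : (X -> R[i]) -> R[i]) : Prop := IsState {
  state_linear : forall (a : R[i]) f g, bounded_fct f -> bounded_fct g ->
    m (fun x => a * f x + g x)%R = (a * m f + m g)%R;
  state_ge0 : forall f, bounded_fct f -> (forall x, 0 <= f x)%R -> (0 <= m f)%R;
  state_unit : m (fun=> 1%R) = 1%R }.

End State.

Definition invariant_state (G : groupType) (X : Type) (act : G -> X -> X)
    (L : set G) (m : (X -> R[i]) -> R[i]) : Prop :=
  forall s, L s -> forall f, bounded_fct f -> m (fun x => f (act s^-1 x)) = m f.

Definition amenable (G : groupType) : Prop :=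
  exists2 m : (G -> R[i]) -> R[i],
    is_state m & invariant_state (fun s x : G => s * x) setT m.

Section Cosets.
Variables (G : groupType) (L : set G).

Definition left_cosets : set (set G) := [set [set g * h | h in L] | g in setT].

Lemma left_coset_mulP (s : G) (C : left_cosets) :
  [set s * x | x in (\val C : set G)] \in left_cosets.
Proof.
case: C => D /= /set_mem [g _ <-]; apply/mem_set; exists (s * g) => //.
apply/seteqP; split => [_ [h Lh <-]|_ [_ [h Lh <-] <-]].
  by exists (g * h); [exists h | rewrite mulgA].
by exists h; rewrite ?mulgA.
Qed.

Definition left_coset_mul (s : G) (C : left_cosets) : left_cosets :=
  SigSub (left_coset_mulP s C).

End Cosets.

Definition rel_amenable (G : groupType) (L1 L2 : set G) : Prop :=
  exists2 m : (left_cosets L2 -> R[i]) -> R[i],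
    is_state m & invariant_state (@left_coset_mul G L2) L1 m.

End Amenability.

(* ['Z_2] is a [groupType] for its addition. *)
Definition group_isog (G H : groupType) : Prop :=
  exists f : {multiplicative G -> H}, bijective f.

(* Main.v *)
From HB Require Import structures.
Require Import Defs.
From mathcomp Require Import all_boot all_order all_algebra.
From mathcomp Require Import boolp classical_sets reals.
From mathcomp Require Import filter topology normedtype sequences.
From mathcomp Require Import complex lra.

(** The graph product acts on the coset space [Gamma / Gamma_V2], and an
    invariant mean there can be pushed forward along equivariant maps, that
    is, along any action of [Gamma] with a base point fixed by [Gamma_V2]
    ([rel_amenable_push]). Such actions are built from actions of the vertex
    groups that commute along the edges ([gp_action]).

    Necessity. Let [v] be in [V1] and not in [V2]. The retraction of [Gamma]
    onto [Gamma_v] kills [Gamma_V2], so that the mean is pushed to an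
    invariant mean on [Gamma_v] ([amenable_vertex]). If [w] in [V1] is not
    adjacent to [v], let [Gamma] act on the cosets of the free product of [A =
    Gamma_v] and [B], modulo [B], where [B] collects the other vertices that
    are not adjacent to [v]. The cosets whose reduced word starts in [A] are
    moved off each other by the elements of [B], and the others are moved off
    each other by those of [A]. The mean is invariant under [A] and the subgroup [B'] of
    [B] coming from [V1], so that it gives the former mass at most [1/|B'|]
    and the latter mass at most [1/|A|]. As the two masses add up to 1, both
    orders are 2 ([no_pingpong], [off_star_small]). So [Gamma_v] and [Gamma_w]
    have two elements and every other [u] in [V1] is adjacent to [v].

    The same argument does not apply with the roles of [v] and [w] exchanged,
    since [w] may lie in [V2]. Suppose that [u] is adjacent to [v] but not to
    [w]. The kernel of the retraction onto [Gamma_v] contains the free product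
    of [Gamma_w] conjugated by the generator [a] of [Gamma_v] with the group
    generated by [Gamma_u] and [Gamma_w]; the second factor fixes the base
    point and has at least three elements. The induced action of [Gamma]
    ([swap_action]) lives on two copies of the cosets of this free product;
    the two copies are swapped by [a], hence each has mass 1/2, and ping-pong
    inside one of them is contradictory ([nonedge_adjacent_r]).

    Sufficiency. The point mass at the base coset is invariant under
    [Gamma_u] for every [u] in [V2]. The vertices [v] of [V1] outside [V2] are
    treated one after the other: if [v] is adjacent to the rest of [V1],
    average over the amenable group [Gamma_v]; otherwise [v] has a single
    non-neighbour [w] in [V1], and one averages over the infinite dihedral
    group generated by [Gamma_v] and [Gamma_w], by means of a
    translation-invariant state on the natural numbers ([banach_limit]). In
    both cases the group averaged over commutes with the other vertex groups
    of [V1], so that the invariance obtained before is kept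
    ([average_vertex]). *)

Set Implicit Arguments.
Unset Strict Implicit.
Unset Printing Implicit Defensive.

Import Order.TTheory GRing.Theory Num.Theory.

Local Open Scope group_scope.

(** * Actions of groups and of graph products *)

Section Subgroups.
Variables (G : groupType) (H : set G).
Hypothesis H_sub : is_subgroup H.

Lemma is_subgroupV x : H x -> H x^-1.
Proof. by case: H_sub => H1 HB Hx; rewrite -[x^-1]mul1g; exact: HB. Qed.

Lemma is_subgroupM x y : H x -> H y -> H (x * y).
Proof.
case: H_sub => _ HB Hx Hy; rewrite -[y]invgK.
by apply: HB => //; exact: is_subgroupV.
Qed.

End Subgroups.

Section GroupMorphism.
Variables (G H : groupType) (f : {multiplicative G -> H}).

Lemma group_morph1 : f 1 = 1.
Proof. by apply: (@mulgI _ (f 1)); rewrite -gmulfM !mulg1. Qed.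

Lemma group_morphV x : f x^-1 = (f x)^-1.
Proof. by apply/esym/mulg1_eq; rewrite -gmulfM mulgV group_morph1. Qed.

End GroupMorphism.

Record is_action (G : groupType) (T : Type) (act : G -> T -> T) : Prop :=
  IsAction {
    act1 : forall t, act 1 t = t;
    actM : forall x y t, act (x * y) t = act x (act y t) }.

Section ActionTheory.
Variables (G : groupType) (T : Type) (act : G -> T -> T).
Hypothesis act_ok : is_action act.

Lemma actK x : cancel (act x) (act x^-1).
Proof. by move=> t; rewrite -(actM act_ok) mulVg (act1 act_ok). Qed.

Lemma actKV x : cancel (act x^-1) (act x).
Proof. by move=> t; rewrite -(actM act_ok) mulgV (act1 act_ok). Qed.

Lemma stabilizer_subgroup t0 :
  is_subgroup [set g | act g t0 = t0]%classic.
Proof.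
split=> [|x y /= xt yt]; first exact: (act1 act_ok).
by rewrite (actM act_ok) -{1}yt actK.
Qed.

End ActionTheory.

Lemma gp_sub_min (V : finType) (e : rel V) (G : V -> groupType) (U : {set V})
    (P : set (graph_product e G)) :
  is_subgroup P -> (forall v (x : G v), v \in U -> P (gp_of e x)) ->
  (gp_sub e G U `<=` P)%classic.
Proof.
move=> Psub PU; apply: smallest_sub => // _ [v /= vU [x _ <-]]; exact: PU.
Qed.

Lemma gp_sub_of (V : finType) (e : rel V) (G : V -> groupType) (U : {set V})
    v (x : G v) : v \in U -> gp_sub e G U (gp_of e x).
Proof. by move=> vU P [_ PU]; apply: PU; exists v => //; exists x. Qed.

Lemma gp_sub_subgroup (V : finType) (e : rel V) (G : V -> groupType)
    (U : {set V}) : is_subgroup (gp_sub e G U).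
Proof.
split=> [P [[P1 _] _] //|x y Ux Uy P [Psub PU]].
by case: (Psub) => _; apply; [apply: Ux | apply: Uy].
Qed.

Section GraphProductAction.
Variables (V : finType) (e : rel V) (G : V -> groupType) (T : Type).
Variable a : forall v, G v -> T -> T.
Hypothesis a_ok : forall v, is_action (@a v).
Hypothesis aC : forall v w (x : G v) (y : G w) t, e v w ->
  a x (a y t) = a y (a x t).

(** The universal property of the graph product, with the self-maps of [T] as
    target; words are evaluated directly, so that no group of permutations
    of [T] has to be constructed. *)
Lemma gp_action : exists2 act : graph_product e G -> T -> T,
  is_action act & forall v (x : G v) t, act (gp_of e x) t = a x t.
Proof.
pose ev (s : gp_word G) (t : T) := foldr (fun i => a (tagged i)) t s.
have evcat r s t : ev (r ++ s) t = ev r (ev s t) by rewrite /ev foldr_cat.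
have evP r s : gp_rel e r s -> ev r =1 ev s.
  elim=> {r s} //.
  - by move=> r s _ rs t.
  - by move=> r s u _ rs _ su t; rewrite rs su.
  - by move=> r r' s s' _ rr _ ss t; rewrite !evcat ss rr.
  - by move=> v t; rewrite /ev /= (act1 (a_ok v)).
  - by move=> v x y t; rewrite /ev /= (actM (a_ok v)).
  - by move=> v w x y evw t; rewrite /ev /= aC.
pose act (x : graph_product e G) := ev (repr x).
have actE s : act (gp_pi e s) =1 ev s by apply: evP; exact: gp_rel_repr.
exists act; last by move=> v x t; rewrite actE.
split=> [t|x y t]; first by rewrite (actE [::]).
case: (gp_repr x) (gp_repr y) => [r ->] [s ->].
by rewrite (gp_mulE e r s : _ * _ = _) !actE evcat.
Qed.

End GraphProductAction.

Section Coordinate.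
Variables (V : finType) (G : V -> groupType) (v : V).

Definition gcoord (w : V) (x : G w) : G v :=
  if w =P v is ReflectT E then ecast z (G z) E x else 1.

Lemma gcoord_id (x : G v) : gcoord x = x.
Proof. by rewrite /gcoord; case: eqP => // E; rewrite eq_axiomK. Qed.

Lemma gcoord_neq w (x : G w) : w != v -> gcoord x = 1.
Proof. by rewrite /gcoord; case: eqP. Qed.

Lemma gcoord1 w : gcoord (1 : G w) = 1.
Proof. by rewrite /gcoord; case: eqP => // E; case: _ / E. Qed.

Lemma gcoordM w : {morph @gcoord w : x y / x * y}.
Proof.
move=> x y; rewrite /gcoord; case: eqP => [E|_]; last by rewrite mulg1.
by case: _ / E.
Qed.

(** Killing every factor but [G v] retracts the graph product onto [G v]; this
    is the resulting action on [G v] by left translation. *)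
Lemma gcoord_action (e : rel V) : irreflexive e ->
  exists2 act : graph_product e G -> G v -> G v, is_action act &
    forall w (x : G w) t, act (gp_of e x) t = gcoord x * t.
Proof.
move=> e_irr; apply: gp_action => [w|w z x y t ewz].
  by split=> [t|x y t]; rewrite ?gcoord1 ?mul1g // gcoordM mulgA.
have [wv|/gcoord_neq->] := eqVneq w v; last by rewrite !mul1g.
rewrite (@gcoord_neq z) ?mul1g // -wv.
by apply: contraTneq ewz => ->; rewrite e_irr.
Qed.

End Coordinate.

Section GpOf.
Variables (V : finType) (e : rel V) (G : V -> groupType).
Hypothesis e_irr : irreflexive e.

Lemma gp_of_inj v : injective (@gp_of V e G v).
Proof.
move=> x y xy; have [act _ actE] := @gcoord_action V G v e e_irr.
by have := actE _ x 1; rewrite xy actE !mulg1 !gcoord_id.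
Qed.

Lemma gp_of_disjoint v w (x : G v) (y : G w) :
  v != w -> gp_of e x = gp_of e y -> x = 1.
Proof.
move=> vw xy; have [act _ actE] := @gcoord_action V G v e e_irr.
have := actE _ x 1; rewrite xy actE !mulg1 gcoord_id => <-.
by apply: gcoord_neq; rewrite eq_sym.
Qed.

End GpOf.

(** * The coset space of a free product modulo a factor *)

Section FreeProductCosets.
Variables A B : groupType.

(** A coset in [(A * B) / B] is [a0 b1 a1 ... bn an B] for a unique reduced
    word, in which all letters but [a0] are nontrivial; it is encoded as
    [(a0, [:: (b1, a1); ...; (bn, an)])]. Words that are not reduced are kept
    in the type, and [B] does not move a word that is not reduced at the head,
    which spares a subtype. *)
Definition fp_coset := (A * seq (B * A))%type.

Definition fp_base : fp_coset := (1, [::]).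

Definition fp_actA (a : A) (y : fp_coset) : fp_coset := (a * y.1, y.2).

(** The coset [b a l], where [b] may be trivial. *)
Definition fp_cons (z : B * A * seq (B * A)) : fp_coset :=
  if z.1.1 == 1 then (z.1.2, z.2) else (1, z.1 :: z.2).

Definition fp_uncons (y : fp_coset) : option (B * A * seq (B * A)) :=
  if y.1 != 1 then Some (1, y.1, y.2)
  else if y.2 is (b, a) :: l then
    if (b != 1) && (a != 1) then Some (b, a, l) else None
  else None.

Definition fp_actB (b : B) (y : fp_coset) : fp_coset :=
  if fp_uncons y is Some (b', a, l) then fp_cons (b * b', a, l) else y.

Lemma fp_unconsK y z : fp_uncons y = Some z -> fp_cons z = y /\ z.1.2 != 1.
Proof.
case: y => a0 l; rewrite /fp_uncons /fp_cons /=.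
case: eqVneq => [->|a0N1] /=; last by case=> <- /=; rewrite eqxx.
case: l => [//|[b a] l]; case: ifP => // /andP[bN1 aN1] [<-] /=.
by rewrite (negbTE bN1).
Qed.

Lemma fp_consK (z : B * A * seq (B * A)) :
  z.1.2 != 1 -> fp_uncons (fp_cons z) = Some z.
Proof.
case: z => [[b a] l] /= aN1; rewrite /fp_cons /fp_uncons /=.
by case: (eqVneq b 1) => [->|bN1] /=; rewrite ?aN1 // eqxx /= bN1.
Qed.

Lemma fp_actA_action : is_action fp_actA.
Proof. by split=> [[a l]|x y [a l]]; rewrite /fp_actA /= ?mul1g ?mulgA. Qed.

Lemma fp_actB_action : is_action fp_actB.
Proof.
split=> [y|b c y]; rewrite /fp_actB; case E: (fp_uncons y) => [[[b' a] l]|].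
- by rewrite mul1g; case: (fp_unconsK E).
- by [].
- have [_ /= aN1] := fp_unconsK E.
  by rewrite fp_consK //= mulgA.
- by rewrite E.
Qed.

Lemma fp_actB_base b : fp_actB b fp_base = fp_base.
Proof. by rewrite /fp_actB /fp_uncons /= eqxx. Qed.

(** Ping: distinct elements of [A] move the cosets with [a0 = 1] off each
    other. *)
Lemma fp_actA_disjoint a a' y y' :
  y.1 = 1 -> y'.1 = 1 -> fp_actA a y = fp_actA a' y' -> a = a'.
Proof. by move=> y1 y'1 [+ _]; rewrite y1 y'1 !mulg1. Qed.

(** Pong: distinct elements of [B] move the cosets with [a0 != 1] off each
    other. *)
Lemma fp_actB_disjoint b b' y y' :
  y.1 != 1 -> y'.1 != 1 -> fp_actB b y = fp_actB b' y' -> b = b'.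
Proof.
case: y y' => [a l] [a' l'] /= aN1 a'N1.
rewrite /fp_actB /fp_uncons /= aN1 a'N1 !mulg1.
by move=> /(congr1 fp_uncons); rewrite !fp_consK //; case.
Qed.

End FreeProductCosets.

(** * States and their invariance groups *)

Section StateTheory.
Variables (R : realType).
Local Notation C := R[i].
Local Open Scope ring_scope.

Section Bounded.
Variable X : Type.
Implicit Types f g : X -> C.

Lemma bounded_cst (c : C) : bounded_fct (fun _ : X => c).
Proof. by exists `|c|. Qed.

Lemma bounded_comp Y (h : Y -> X) f :
  bounded_fct f -> bounded_fct (fun y => f (h y)).
Proof. by move=> [M fM]; exists M => y; exact: fM. Qed.

Lemma bounded_lin (c : C) f g :
  bounded_fct f -> bounded_fct g -> bounded_fct (fun x => c * f x + g x).
Proof.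
move=> [M fM] [N gN]; exists (`|c| * M + N) => x.
by rewrite (le_trans (ler_normD _ _)) // lerD // normrM ler_wpM2l.
Qed.

Lemma bounded_ind (S : pred X) : bounded_fct (fun x => (S x)%:R : C).
Proof. by exists 1 => x; rewrite normr_nat; case: (S x); rewrite ?ler01. Qed.

Lemma bounded_sum I (s : seq I) (F : I -> X -> C) :
  (forall i, bounded_fct (F i)) -> bounded_fct (fun x => \sum_(i <- s) F i x).
Proof.
move=> FB; elim: s => [|i s [N sN]].
  by exists 0 => x; rewrite big_nil normr0.
have [M FM] := FB i; exists (M + N) => x.
by rewrite big_cons (le_trans (ler_normD _ _)) // lerD.
Qed.

End Bounded.

Section OneState.
Variables (X : Type) (m : (X -> C) -> C).
Hypothesis m_ok : is_state m.
Implicit Types f g : X -> C.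

Lemma state0 : m (fun=> 0) = 0.
Proof.
have := state_linear m_ok 1 (bounded_cst X 0) (bounded_cst X 0).
rewrite !mul1r addr0 => /esym/eqP; rewrite -[eqbRHS]addr0.
by rewrite (inj_eq (addrI _)) => /eqP.
Qed.

Lemma stateZ c f : bounded_fct f -> m (fun x => c * f x) = c * m f.
Proof.
move=> fB; have := state_linear m_ok c fB (bounded_cst X 0).
by rewrite state0 addr0 => <-; congr m; apply/funext => x; rewrite addr0.
Qed.

Lemma stateD f g : bounded_fct f -> bounded_fct g ->
  m (fun x => f x + g x) = m f + m g.
Proof.
move=> fB gB; have := state_linear m_ok 1 fB gB.
by rewrite mul1r => <-; congr m; apply/funext => x; rewrite mul1r.
Qed.

Lemma state_cst c : m (fun=> c) = c.
Proof.
rewrite -[RHS]mulr1 -(state_unit m_ok) -stateZ; last exact: bounded_cst.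
by congr m; apply/funext => x; rewrite mulr1.
Qed.

Lemma state_le f g : bounded_fct f -> bounded_fct g ->
  (forall x, f x <= g x) -> m f <= m g.
Proof.
move=> fB gB fg; rewrite -subr_ge0.
have -> : m g - m f = m (fun x => (-1) * f x + g x).
  by rewrite (state_linear m_ok) // mulN1r addrC.
apply: (state_ge0 m_ok); first exact: bounded_lin.
by move=> x; rewrite mulN1r addrC subr_ge0.
Qed.

Lemma state_sum I (s : seq I) (F : I -> X -> C) :
  (forall i, bounded_fct (F i)) ->
  m (fun x => \sum_(i <- s) F i x) = \sum_(i <- s) m (F i).
Proof.
move=> FB; elim: s => [|i s IHs].
  by rewrite big_nil -[RHS]state0; congr m; apply/funext => x; rewrite big_nil.
rewrite big_cons -IHs -stateD //; last exact: bounded_sum.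
by congr m; apply/funext => x; rewrite big_cons.
Qed.

(** The factor 2 comes from bounding the real and the imaginary part
    separately. *)
Lemma state_bound f (M : C) : 0 <= M -> (forall x, `|f x| <= M) ->
  `|m f| <= M *+ 2.
Proof.
move=> M0 fM; have MR : M \is Num.real by exact: ger0_real.
have norm_i : `|'i%C| = 1 :> C.
  by rewrite normc_def /= expr0n /= add0r expr1n sqrtr1.
have realP (g : X -> R) : (forall x, `|(g x)%:C%C| <= M) ->
    `|m (fun x => (g x)%:C%C)| <= M.
  move=> gM; have gB : bounded_fct (fun x => (g x)%:C%C) by exists M.
  have gR x : (g x)%:C%C \is Num.real by apply/complex_realP; exists (g x).
  have mgl : - M <= m (fun x => (g x)%:C%C).
    rewrite -[leLHS](state_cst (- M)); apply: state_le => [||x] //.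
      exact: bounded_cst.
    by have := gM x; rewrite real_ler_norml // => /andP[].
  have mgr : m (fun x => (g x)%:C%C) <= M.
    rewrite -[leRHS](state_cst M); apply: state_le => [||x] //.
      exact: bounded_cst.
    by have := gM x; rewrite real_ler_norml // => /andP[].
  rewrite real_ler_norml ?mgl ?mgr //.
  by rewrite (ler_real mgr).
have ReM x : `|(complex.Re (f x))%:C%C| <= M.
  apply: le_trans (fM x); apply: le_trans (normc_ge_Re (f x)).
  by rewrite normc_def /= expr0n /= addr0 sqrtr_sqr lexx.
have ImM x : `|(complex.Im (f x))%:C%C| <= M.
  apply: le_trans (fM x).
  rewrite -[leRHS]mulr1 -norm_i -normrM; apply: le_trans (normc_ge_Re _).
  rewrite ReiNIm normrN.
  by rewrite normc_def /= expr0n /= addr0 sqrtr_sqr lexx.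
have -> : m f = 'i%C * m (fun x => (complex.Im (f x))%:C%C) +
    m (fun x => (complex.Re (f x))%:C%C).
  rewrite -(state_linear m_ok); try by exists M.
  by congr m; apply/funext => x; rewrite addrC -complexE.
rewrite (le_trans (ler_normD _ _)) // mulr2n lerD ?realP // normrM.
by rewrite norm_i mul1r realP.
Qed.

Lemma bounded_state J (F : J -> X -> C) :
  (exists M : C, forall j x, `|F j x| <= M) -> bounded_fct (fun j => m (F j)).
Proof.
move=> [M FM]; exists (`|M| *+ 2) => j; apply: state_bound => // x.
by rewrite [`|M|]ger0_norm //; exact: le_trans (normr_ge0 _) (FM j x).
Qed.

End OneState.

Lemma state_push X Y (q : X -> Y) (m : (X -> C) -> C) :
  is_state m -> is_state (fun f : Y -> C => m (fun x => f (q x))).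
Proof.
move=> mS; split=> [c f g fB gB|f fB f0|]; last exact: (state_unit mS).
  by rewrite (state_linear mS) //; exact: bounded_comp.
by apply: (state_ge0 mS) => //; exact: bounded_comp.
Qed.

Section Invariants.
Variables (G : groupType) (X : Type) (act : G -> X -> X).
Hypothesis act_ok : is_action act.

(** The elements that fix the state [m]; stating invariance through this group
    lets it be checked on generators. *)
Definition invariants (m : (X -> C) -> C) : set G :=
  [set g | forall f, bounded_fct f ->
     m (fun x => f (act g^-1 x)%g) = m f]%classic.

Lemma invariants_subgroup m : is_subgroup (invariants m).
Proof.
have mul g h : invariants m g -> invariants m h -> invariants m (g * h)%g.
  move=> mg mh f fB; rewrite -[RHS]mh // -[RHS]mg; last exact: bounded_comp.
  by congr m; apply/funext => x; rewrite invgM (actM act_ok).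
split=> [f fB|g h mg mh].
  by congr m; apply/funext => x; rewrite invg1 (act1 act_ok).
apply: mul => // f fB; rewrite -[LHS]mh; last exact: bounded_comp.
by congr m; apply/funext => x; rewrite invgK (actKV act_ok).
Qed.

Definition average J (l : (J -> C) -> C) (c : J -> G) (m : (X -> C) -> C)
    (f : X -> C) : C :=
  l (fun j => m (fun x => f (act (c j) x))).

Section Average.
Variables (J : Type) (l : (J -> C) -> C) (c : J -> G) (m : (X -> C) -> C).
Hypothesis l_ok : is_state l.
Hypothesis m_ok : is_state m.

Lemma bounded_translates f : bounded_fct f ->
  bounded_fct (fun j => m (fun x => f (act (c j) x))).
Proof. by move=> [M fM]; apply: bounded_state => //; exists M. Qed.

Lemma average_state : is_state (average l c m).
Proof.
split=> [k f g fB gB|f fB f0|]; rewrite /average.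
- rewrite -(state_linear l_ok); try exact: bounded_translates.
  congr l; apply/funext => j.
  by rewrite (state_linear m_ok) //; exact: bounded_comp.
- apply: (state_ge0 l_ok); first exact: bounded_translates.
  by move=> j; apply: (state_ge0 m_ok) => //; exact: bounded_comp.
- rewrite -[RHS](state_unit l_ok); congr l; apply/funext => j.
  by rewrite (state_unit m_ok).
Qed.

(** Since [g * c j = c j * (c j)^-1 * g * c j], translating the average by [g]
    translates its [j]-th term by a conjugate of [g]. *)
Lemma average_normalizes g :
  (forall j, invariants m ((c j)^-1 * g * c j)%g) ->
  invariants (average l c m) g.
Proof.
move=> mg f fB; congr l; apply/funext => j.
rewrite -[RHS](mg j); last exact: bounded_comp.
congr m; apply/funext => x.
by rewrite !invgM invgK -!(actM act_ok) !mulgA mulgV mul1g.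
Qed.

Lemma average_centralizes g : (forall j, commute g (c j)) ->
  invariants m g -> invariants (average l c m) g.
Proof.
move=> gc mg; apply: average_normalizes => j.
by rewrite -mulgA gc mulKg.
Qed.

End Average.

Lemma average_group (P : groupType) (l : (P -> C) -> C)
    (c : {multiplicative P -> G}) m :
  is_state m -> invariant_state (fun s x : P => (s * x)%g) setT l ->
  forall p, invariants (average l c m) (c p).
Proof.
move=> mS lI p f fB.
rewrite /average -[RHS](lI p I); last first.
  exact: (@bounded_translates P c m mS f fB).
congr l; apply/funext => q; congr m; apply/funext => x.
by rewrite gmulfM group_morphV (actM act_ok).
Qed.

End Invariants.

End StateTheory.

(** * A translation-invariant state on the natural numbers *)

Section BanachLimit.
Import numFieldNormedType.Exports.
Variable R : realType.
Local Open Scope ring_scope.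
Local Open Scope classical_set_scope.
Local Notation C := R[i].

Section UltraLimit.
Variable U : set_system nat.
Hypothesis U_ultra : UltraFilter U.
Implicit Types u : nat -> R.

(** The image of an ultrafilter is an ultrafilter, and [[-M, M]] is compact. *)
Lemma ultra_cvg u (M : R) : (forall n, `|u n| <= M) -> cvg (u @ U).
Proof.
move=> uM; have : compact `[- M, M]%classic by exact: segment_compact.
rewrite compact_ultra => /(_ (u @ U)) [||l [_ ul]].
- split=> [|F F_proper UF]; first exact: fmap_proper_filter.
  apply/seteqP; split=> // A FA; rewrite /= /fmap /=.
  have [//|nA] := in_ultra_setVsetC (u @^-1` A) U_ultra.
  have {}nA : F (~` A) by apply: UF.
  by have [x []] := filter_ex (filterI FA nA).
- apply: (@filterE nat U) => n /=; rewrite in_itv /= -ler_norml; exact: uM.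
- by apply/cvg_ex; exists l.
Qed.

End UltraLimit.

Definition bounded_seq (u : nat -> R) : Prop := exists M, forall n, `|u n| <= M.

Definition cesaro (u : nat -> R) (n : nat) : R :=
  (\sum_(k < n.+1) u k) / n.+1%:R.

Lemma cesaro_lin a u v n :
  cesaro (fun k => a * u k + v k) n = a * cesaro u n + cesaro v n.
Proof. by rewrite /cesaro big_split /= -mulr_sumr mulrDl mulrA. Qed.

Lemma cesaro_bound u M n : (forall k, `|u k| <= M) -> `|cesaro u n| <= M.
Proof.
move=> uM; rewrite /cesaro normrM normfV [`|n.+1%:R|]ger0_norm //.
rewrite ler_pdivrMr ?ltr0Sn // (le_trans (ler_norm_sum _ _ _)) //.
rewrite mulr_natr -[in leRHS](card_ord n.+1) -sumr_const; exact: ler_sum.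
Qed.

Lemma cesaro_shift u n :
  cesaro (fun k => u k.+1) n - cesaro u n = (u n.+1 - u 0%N) / n.+1%:R.
Proof.
rewrite /cesaro -mulrBl big_ord_recr [in X in _ - X]big_ord_recl /=.
by congr (_ / _); rewrite opprD addrCA addrC; lra.
Qed.

(** The limit of the Cesaro means along an ultrafilter finer than the filter of
    neighbourhoods of infinity: it exists for every bounded sequence, and
    shifting the sequence changes its [n]-th mean by [O(1/n)]. *)
Lemma real_banach_limit : exists l : (nat -> R) -> R, [/\
  forall a u v, bounded_seq u -> bounded_seq v ->
    l (fun n => a * u n + v n) = a * l u + l v,
  forall u, bounded_seq u -> (forall n, 0 <= u n) -> 0 <= l u,
  l (fun=> 1) = 1 &
  forall u, bounded_seq u -> l (fun n => u n.+1) = l u].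
Proof.
have [U [U_ultra U_oo]] := @ultraFilterLemma nat \oo _.
have U_proper : ProperFilter U := @ultra_proper _ _ U_ultra.
have cvgU u : bounded_seq u -> cvg (cesaro u @ U).
  move=> [M uM]; apply: (@ultra_cvg U U_ultra _ M) => n; exact: cesaro_bound.
exists (fun u => lim (cesaro u @ U)); split.
- move=> a u v uB vB; apply: cvg_lim => //.
  have -> : cesaro (fun n => a * u n + v n) =
      fun n => a * cesaro u n + cesaro v n.
    by apply/funext => n; rewrite cesaro_lin.
  by apply: cvgD; [apply: cvgMl_tmp|]; exact: cvgU.
- move=> u uB u0; apply: limr_ge; first exact: cvgU.
  by apply: (@filterE nat U) => n; rewrite divr_ge0 // sumr_ge0.
- apply: cvg_lim => //.
  have -> : cesaro (fun=> 1) = fun=> 1 :> R.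
    apply/funext => n; rewrite /cesaro sumr_const card_ord divff //.
    by rewrite pnatr_eq0.
  exact: cvg_cst.
- move=> u [M uM]; have uB : bounded_seq u by exists M.
  have uB' : bounded_seq (fun n => u n.+1) by exists M.
  apply/eqP; rewrite -subr_eq0 -limB; [|exact: cvgU|exact: cvgU].
  apply/eqP/cvg_lim => //; apply: cvg_trans (cvg_app _ U_oo) _.
  have h0 (c : R) : c * harmonic n @[n --> \oo] --> 0.
    by rewrite -[X in _ --> X](mulr0 c); apply: cvgMl_tmp; exact: cvg_harmonic.
  apply: (squeeze_cvgr _ (h0 (- (M *+ 2))) (h0 (M *+ 2))).
  apply: filterE => n /=.
  rewrite -[X in _ <= X <= _]/(cesaro (fun k => u k.+1) n - cesaro u n).
  rewrite cesaro_shift mulNr -ler_norml normrM normfV [`|n.+1%:R|]ger0_norm //.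
  rewrite ler_wpM2r ?invr_ge0 //.
  by rewrite (le_trans (ler_normB _ _)) // mulr2n lerD.
Qed.

Lemma banach_limit : exists2 l : (nat -> C) -> C, is_state l &
  forall f, bounded_fct f -> l (fun n => f n.+1) = l f.
Proof.
have [l [l_lin l_ge0 l_unit l_shift]] := real_banach_limit.
have l0 : l (fun=> 0) = 0.
  have B0 : bounded_seq (fun=> 0) by exists 0 => n; rewrite normr0.
  have := l_lin 1 _ _ B0 B0; rewrite !mul1r addr0; lra.
have ReB f : bounded_fct f -> bounded_seq (fun n => complex.Re (f n)).
  move=> [M fM]; exists (complex.Re M) => n.
  have := le_trans (normc_ge_Re _) (fM n).
  by rewrite lecE /= => /andP[].
have ImB f : bounded_fct f -> bounded_seq (fun n => complex.Im (f n)).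
  move=> fB; have /ReB [M fM] : bounded_fct (fun n => f n * 'i%C).
    by case: fB => M fM; exists (M * `|'i%C|) => n; rewrite normrM ler_wpM2r.
  by exists M => n; have := fM n; rewrite ReiNIm normrN.
exists (fun f => (l (fun n => complex.Re (f n)) +i*
                  l (fun n => complex.Im (f n)))%C).
  split.
  - move=> [a b] f g fB gB.
    have fR := ReB _ fB; have fI := ImB _ fB.
    have gR := ReB _ gB; have gI := ImB _ gB.
    have linB c u v : bounded_seq u -> bounded_seq v ->
        bounded_seq (fun n => c * u n + v n).
      move=> [M uM] [N vN]; exists (`|c| * M + N) => n.
      by rewrite (le_trans (ler_normD _ _)) // lerD // normrM ler_wpM2l.
    apply/eqP; rewrite eq_complex; apply/andP; split; apply/eqP => /=.
      transitivity (l (fun n => a * complex.Re (f n) +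
          ((- b) * complex.Im (f n) + complex.Re (g n)))).
        by congr l; apply/funext => n; case: (f n) (g n) => [x y] [z t] /=; lra.
      by rewrite !l_lin //; [lra|exact: linB].
    transitivity (l (fun n => a * complex.Im (f n) +
        (b * complex.Re (f n) + complex.Im (g n)))).
      by congr l; apply/funext => n; case: (f n) (g n) => [x y] [z t] /=; lra.
    by rewrite !l_lin //; [lra|exact: linB].
  - move=> f fB f0; rewrite lecE /=; apply/andP; split.
      rewrite -[X in _ == X]l0 eq_sym; apply/eqP; congr l; apply/funext => n.
      exact/esym/ger0_Im.
    apply: l_ge0; first exact: ReB.
    by move=> n; have := f0 n; rewrite lecE /= => /andP[].
  - by rewrite /= l0 l_unit.
move=> f fB; congr (_ +i* _)%C.
  exact: (l_shift (fun n => complex.Re (f n)) (ReB _ fB)).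
exact: (l_shift (fun n => complex.Im (f n)) (ImB _ fB)).
Qed.

End BanachLimit.

(** * Paradoxical configurations *)

Section Paradox.
Variable R : realType.
Local Notation C := R[i].
Local Open Scope ring_scope.

(** An action with a point fixed by [L2] receives an equivariant map from the
    cosets of [L2], along which means are pushed forward. *)
Lemma rel_amenable_push (G : groupType) (L1 L2 : set G) (T : Type)
    (act : G -> T -> T) (t0 : T) :
  is_action act -> is_subgroup L2 -> (forall h, L2 h -> act h t0 = t0) ->
  rel_amenable R L1 L2 ->
  exists2 m : (T -> C) -> C, is_state m & forall g, L1 g -> invariants act m g.
Proof.
move=> act_ok L2_sub t0_fix [m mS mI].
have cosetP (D : left_cosets L2) : exists g,
    (\val D : set G) = [set (g * h)%g | h in L2]%classic.
  by case: D => D /= /set_mem [g _ <-]; exists g.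
pose q D := act (sval (cid (cosetP D))) t0.
have qE g (D : left_cosets L2) :
    (\val D : set G) = [set (g * h)%g | h in L2]%classic -> q D = act g t0.
  move=> DE; rewrite /q; case: cid => g' DE' /=.
  have [h L2h <-] : [set (g * h)%g | h in L2]%classic g'.
    by rewrite -DE DE'; exists 1%g; rewrite ?mulg1 //; case: L2_sub.
  by rewrite (actM act_ok) t0_fix.
exists (fun f => m (fun D => f (q D))); first exact: state_push.
move=> s L1s f fB; rewrite -[RHS](mI s L1s); last exact: bounded_comp.
congr m; apply/funext => D; congr f; have [g DE] := cosetP D.
rewrite (qE _ _ DE) -(actM act_ok); apply/esym/qE; rewrite /= DE.
apply/seteqP; split => [_ [_ [h L2h <-] <-]|_ [h L2h <-]].
  by exists h; rewrite ?mulgA.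
by exists (g * h)%g; [exists h|rewrite mulgA].
Qed.

Section Mass.
Variables (X : Type) (m : (X -> C) -> C).
Hypothesis m_ok : is_state m.
Implicit Types S Z : pred X.

(** The finitely additive measure of a state; since it is real, it can be
    handled by linear arithmetic. *)
Definition mass S : R := complex.Re (m (fun x => (S x)%:R)).

Lemma mass_T : mass predT = 1.
Proof. by rewrite /mass (state_unit m_ok). Qed.

Lemma mass_split S Z : subpred S Z ->
  mass Z = mass S + mass [pred x | Z x && ~~ S x].
Proof.
move=> SZ; rewrite /mass -raddfD /= -(stateD m_ok); try exact: bounded_ind.
congr (complex.Re (m _)); apply/funext => x /=.
by have := SZ x; case: (S x) => [->|_] //=; rewrite ?addr0 ?andbT ?add0r.
Qed.

Variables (G : groupType) (act : G -> X -> X).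
Hypothesis act_ok : is_action act.

(** Invariance gives every translate of [S] the mass of [S], and disjointness
    allows these masses to be added. *)
Lemma mass_packing (s : seq G) S Z : uniq s ->
  {in s, forall g, invariants act m g} ->
  {in s, forall g x, S x -> Z (act g x)} ->
  {in s &, forall g h x y, S x -> S y -> act g x = act h y -> g = h} ->
  mass S *+ size s <= mass Z.
Proof.
move=> s_uniq s_inv sZ s_disj.
have tB g : bounded_fct (fun x => (S (act g^-1%g x))%:R : C).
  exact: (bounded_comp _ (bounded_ind R S)).
suff : m (fun x => (S x)%:R) *+ size s <= m (fun x => (Z x)%:R).
  by rewrite lecE => /andP[_]; rewrite raddfMn.
have -> : m (fun x => (S x)%:R) *+ size s =
    \sum_(g <- s) m (fun x => (S (act g^-1%g x))%:R).
  rewrite -iter_addr_0 -(count_predT s) -big_const_seq big_seq [RHS]big_seq.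
  by apply: eq_bigr => g /s_inv /(_ _ (bounded_ind R S)).
rewrite -(state_sum m_ok) //; apply: (state_le m_ok) => [||x].
- exact: bounded_sum.
- exact: bounded_ind.
rewrite -natr_sum ler_nat.
pose t := [seq g <- s | S (act g^-1%g x)].
have t_eq g h : g \in t -> h \in t -> g = h.
  rewrite !mem_filter => /andP[Sg sg] /andP[Sh sh].
  by apply: (s_disj _ _ sg sh _ _ Sg Sh); rewrite !(actKV act_ok).
have -> : (\sum_(g <- s) S (act g^-1%g x))%N = size t.
  rewrite size_filter -sum1_count [RHS]big_mkcond.
  by apply: eq_bigr => g _; case: (S _).
have : uniq t by rewrite filter_uniq.
have tP g : g \in t -> Z x.
  rewrite mem_filter => /andP[Sg sg].
  by have := sZ g sg _ Sg; rewrite (actKV act_ok).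
case: (t) t_eq tP => [//|g [|h r]] t_eq tP; first by rewrite (tP g) ?mem_head.
by rewrite /= (t_eq g h) ?inE ?eqxx ?orbT.
Qed.

(** Ping-pong: an invariant mean on [Z] would give [S] mass at most
    [1 / size sB] and its complement in [Z] mass at most [1 / size sA], and
    these two numbers do not add up to 1. *)
Lemma no_pingpong (sA sB : seq G) S Z : subpred S Z -> 0 < mass Z ->
  uniq sA -> {in sA, forall g, invariants act m g} ->
  {in sA, forall g x, Z x -> ~~ S x -> Z (act g x)} ->
  {in sA &, forall g h x y, Z x -> ~~ S x -> Z y -> ~~ S y ->
    act g x = act h y -> g = h} ->
  uniq sB -> {in sB, forall g, invariants act m g} ->
  {in sB, forall g x, S x -> Z (act g x)} ->
  {in sB &, forall g h x y, S x -> S y -> act g x = act h y -> g = h} ->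
  (1 < size sA)%N -> (1 < size sB)%N -> (4 < size sA + size sB)%N -> False.
Proof.
move=> SZ Z0 uA iA zA dA uB iB zB dB A2 B2 AB5.
have le0 T : 0 <= mass T.
  have : 0 <= m (fun x => (T x)%:R).
    by apply: (state_ge0 m_ok) => [|x]; [exact: bounded_ind|exact: ler0n].
  by rewrite lecE => /andP[].
pose D : pred X := [pred x | Z x && ~~ S x].
have split : mass Z = mass S + mass D by exact: mass_split.
have S0 := le0 S; have D0 := le0 D.
have leB : mass S *+ size sB <= mass Z by exact: mass_packing.
have leA : mass D *+ size sA <= mass Z.
  apply: mass_packing => // [g gA x|g h gA hA x y]; rewrite /D /=.
    by move=> /andP[]; exact: zA.
  by move=> /andP[? ?] /andP[? ?]; exact: dA.
have le2A : mass D *+ 2 <= mass Z by apply: le_trans leA; exact: ler_wpMn2l.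
have le2B : mass S *+ 2 <= mass Z by apply: le_trans leB; exact: ler_wpMn2l.
have [A3|A3] := ltnP 2 (size sA).
  have : mass D *+ 3 <= mass Z by apply: le_trans leA; exact: ler_wpMn2l.
  lra.
have B3 : (2 < size sB)%N.
  by rewrite -(ltn_add2l 2); apply: leq_trans AB5 _; rewrite leq_add2r.
have : mass S *+ 3 <= mass Z by apply: le_trans leB; exact: ler_wpMn2l.
lra.
Qed.

End Mass.

End Paradox.

(** * Groups with two elements *)

Definition two_elements (G : groupType) : Prop :=
  exists2 a : G, a != 1 & forall x, x = 1 \/ x = a.

Lemma two_elements_sq (G : groupType) (x : G) : two_elements G -> x * x = 1.
Proof.
move=> [a aN1 G2]; case: (G2 x) => ->; first by rewrite mulg1.
case: (G2 (a * a)) => // aa; case/eqP: aN1.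
by apply: (@mulgI _ a); rewrite aa mulg1.
Qed.

Lemma two_elements_isogP (G : groupType) :
  group_isog G 'Z_2 <-> two_elements G.
Proof.
split=> [[f [g fK gK]]|G2].
  have f1 : f 1 = 1 := group_morph1 f.
  exists (g (inZp 1)) => [|x].
    by apply/eqP => /(congr1 f); rewrite gK f1 => /(congr1 val).
  rewrite -(fK x); have [->|->] : f x = 1 \/ f x = inZp 1.
  - by case: (f x) => [[|[|n]] lt]; [left|right|]; try exact: val_inj.
  - by left; rewrite -[in RHS](fK 1) f1.
  - by right.
have sq x : x * x = 1 := two_elements_sq x G2.
have [a aN1 aP] := G2.
pose f (x : G) : 'Z_2 := if x == 1 then inZp 0 else inZp 1.
have fM : {morph f : x y / x * y}.
  move=> x y; rewrite /f; case: (aP x) (aP y) => [->|->] [->|->];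
    rewrite ?mul1g ?mulg1 ?sq ?eqxx ?(negbTE aN1); exact: val_inj.
pose fMul := isMultiplicative.Build G 'Z_2 f fM.
pose F : {multiplicative G -> 'Z_2} := HB.pack f fMul.
exists F; exists (fun z : 'Z_2 => if z == inZp 0 then 1 else a) => [x|z] /=.
  by rewrite /f; case: (aP x) => ->; rewrite ?eqxx ?(negbTE aN1).
rewrite /f; case: (eqVneq z (inZp 0)) => [->|zN0]; rewrite ?eqxx //.
rewrite (negbTE aN1); apply: val_inj; case: z zN0 => [[|[|n]] lt] //.
Qed.

(** Ping-pong bounds the size of finite lists of distinct elements; this turns
    such a bound into the order of the group. *)
Lemma two_elements_of (G : groupType) : (exists x : G, x <> 1) ->
  (forall s : seq G, uniq s -> (size s < 3)%N) -> two_elements G.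
Proof.
move=> [a /eqP aN1] small; exists a => // x.
have := small [:: 1; a; x]; rewrite /= !inE !negb_or eq_sym aN1 /=.
case: (eqVneq 1 x) => [->|_]; first by left.
by case: (eqVneq a x) => [->|_ /(_ isT)]; first by right.
Qed.

(** * Obstructions to relative amenability *)

Section Obstruction.
Variables (R : realType) (V : finType) (e : rel V) (G : V -> groupType).
Hypothesis e_irr : irreflexive e.
Hypothesis e_sym : symmetric e.
Variables (V1 V2 : {set V}).
Hypothesis V1_V2 : rel_amenable R (gp_sub e G V1) (gp_sub e G V2).
Local Notation Gam := (graph_product e G).
Local Notation C := R[i].

Lemma push_mean (T : Type) (act : Gam -> T -> T) (t0 : T) : is_action act ->
  (forall v (x : G v), v \in V2 -> act (gp_of e x) t0 = t0) ->
  exists2 m : (T -> C) -> C, is_state m &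
    forall g, gp_sub e G V1 g -> invariants act m g.
Proof.
move=> act_ok t0_fix.
apply: (rel_amenable_push (t0 := t0) act_ok _ _ V1_V2).
  exact: gp_sub_subgroup.
apply: (@gp_sub_min _ _ _ _ [set g | act g t0 = t0]%classic) => //.
exact: stabilizer_subgroup.
Qed.

Lemma amenable_vertex v : v \in V1 :\: V2 -> amenable R (G v).
Proof.
rewrite inE => /andP[vV2 vV1].
have [act act_ok actE] := @gcoord_action V G v e e_irr.
have [w x wV2|m mS mI] := push_mean (t0 := 1) act_ok.
  by rewrite actE gcoord_neq ?mul1g //; apply: contraNneq vV2 => <-.
exists m => // s _ f fB; rewrite -[RHS](mI (gp_of e s)) //.
  2: exact: gp_sub_of.
congr m; apply/funext => x; congr f.
by rewrite -{1}[x](actKV act_ok (gp_of e s)) actE gcoord_id mulKg.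
Qed.

Section FreeAction.
Variable v : V.

(** [Gamma] acts on the cosets of the free product of [G v] and a copy of
    [Gamma] modulo the second factor: the vertices other than [v] that are not
    adjacent to [v] act through the second factor, and the neighbours of [v] act
    trivially. *)
Lemma free_action : exists2 act :
    Gam -> fp_coset (G v) Gam -> fp_coset (G v) Gam,
  is_action act &
  [/\ forall (x : G v) t, act (gp_of e x) t = fp_actA x t,
      forall w (x : G w) t, w != v -> ~~ e v w ->
        act (gp_of e x) t = fp_actB (gp_of e x) t &
      forall w (x : G w), w != v ->
        act (gp_of e x) (fp_base _ _) = fp_base _ _].
Proof.
pose a w (x : G w) (t : fp_coset (G v) Gam) :=
  if w == v then fp_actA (gcoord v x) t
  else if e v w then t else fp_actB (gp_of e x) t.
have aA := fp_actA_action (G v) Gam; have aB := fp_actB_action (G v) Gam.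
have [||act act_ok actE] := @gp_action V e G _ a.
- move=> w; rewrite /a; split=> [t|x y t].
    rewrite gcoord1 (act1 aA) (group_morph1 (@gp_of V e G w)) (act1 aB).
    by case: ifP => // _; case: ifP.
  rewrite gcoordM (actM aA) gp_ofM (actM aB).
  by case: ifP => // _; case: ifP.
- move=> w z x y t ewz; rewrite /a.
  case: (eqVneq w v) => [wv|_]; case: (eqVneq z v) => [zv|_].
  + by rewrite wv zv e_irr in ewz.
  + by have -> : e v z by rewrite -wv.
  + by have -> : e v w by rewrite -zv e_sym.
  + case: ifP; case: ifP => // _ _.
    by rewrite -!(actM aB) (gp_of_comm _ _ ewz).
exists act => //; split.
- by move=> x t; rewrite actE /a eqxx gcoord_id.
- by move=> w x t wv evw; rewrite actE /a (negbTE wv) (negbTE evw).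
- move=> w x wv; rewrite actE /a (negbTE wv) fp_actB_base.
  by case: ifP.
Qed.

End FreeAction.

Section SwapAction.
Variables v w u : V.
Hypotheses (vw : v != w) (vu : v != u) (wu : w != u).
Hypotheses (evw : ~~ e v w) (ewu : ~~ e w u).

(** The kernel of the retraction onto [G v] contains [G u], [G w] and the
    conjugates of [G w] by [G v]. It acts on the cosets of a free product modulo
    its second factor, with [G u] and [G w] in the second factor and the
    nontrivial conjugates of [G w] in the first. This is the action of the whole
    group induced from it; the space consists of one copy of these cosets for
    each element of [G v]. *)
Lemma swap_action : exists2 act :
    Gam -> G v * fp_coset (G w) Gam -> G v * fp_coset (G w) Gam,
  is_action act &
  [/\ forall (x : G v) t, act (gp_of e x) t = (x * t.1, t.2),
      forall (x : G w) t, act (gp_of e x) t =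
        (t.1, if t.1 == 1 then fp_actB (gp_of e x) t.2 else fp_actA x t.2),
      forall (x : G u) t, act (gp_of e x) t = (t.1, fp_actB (gp_of e x) t.2) &
      forall z (x : G z), z != v ->
        act (gp_of e x) (1, fp_base _ _) = (1, fp_base _ _)].
Proof.
pose a z (x : G z) (t : G v * fp_coset (G w) Gam) :=
  if z == v then (gcoord v x * t.1, t.2)
  else if z == w then
    (t.1, if t.1 == 1 then fp_actB (gp_of e x) t.2
          else fp_actA (gcoord w x) t.2)
  else if z == u then (t.1, fp_actB (gp_of e x) t.2) else t.
have aA := fp_actA_action (G w) Gam; have aB := fp_actB_action (G w) Gam.
have [||act act_ok actE] := @gp_action V e G _ a.
- move=> z; rewrite /a; split=> [[p y]|x x' [p y]] /=.
    rewrite !gcoord1 (act1 aA) (group_morph1 (@gp_of V e G z)) (act1 aB) mul1g.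
    by do !case: ifP => // _.
  rewrite !gcoordM (actM aA) gp_ofM (actM aB).
  case: (z == v); first by rewrite mulgA.
  case: (z == w) => /=; first by case: (p == 1).
  by case: (z == u).
- move=> z z' x x' [p y] ezz'; rewrite /a.
  have nself s : (z == s) && (z' == s) = false.
    by apply: contraTF ezz' => /andP[/eqP-> /eqP->]; rewrite e_irr.
  have nadj s t : ~~ e s t ->
      ((z == s) && (z' == t)) || ((z == t) && (z' == s)) = false.
    move=> nst; apply: contraTF ezz'.
    by case/orP => /andP[/eqP-> /eqP->] //; rewrite e_sym.
  move: (nself v) (nself w) (nself u) (nadj v w evw) (nadj w u ewu).
  case: (z == v); case: (z' == v); case: (z == w); case: (z' == w);
    by case: (z == u); case: (z' == u).
exists act => //; split.
- by move=> x [p y]; rewrite actE /a eqxx gcoord_id.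
- by move=> x [p y]; rewrite actE /a eq_sym (negbTE vw) eqxx gcoord_id.
- move=> x [p y].
  by rewrite actE /a eq_sym (negbTE vu) eq_sym (negbTE wu) eqxx.
- move=> z x zv; rewrite actE /a (negbTE zv) /= eqxx fp_actB_base.
  by do !case: ifP => // _.
Qed.

End SwapAction.

(** A supply of elements for the pong side: together with [G v], the vertex
    groups involved generate a free product of [G v] with another group. *)
Definition off_star v (g : Gam) : Prop :=
  exists w (x : G w), [/\ w \in V1, w != v, ~~ e v w & g = gp_of e x].

(** The base coset is fixed by [Gamma_V2] because [v] is not in [V2]. On the
    pushed mean, [sA] and [sB] play ping-pong with the cosets whose reduced word
    starts in [G v]. *)
Lemma off_star_small v (sA : seq (G v)) (sB : seq Gam) : v \in V1 :\: V2 ->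
  uniq sA -> uniq sB -> {in sB, forall g, off_star v g} ->
  (1 < size sA)%N -> (1 < size sB)%N -> (size sA + size sB < 5)%N.
Proof.
rewrite inE => /andP[vV2 vV1] uA uB sB_off A2 B2.
rewrite ltnNge; apply/negP => AB5.
have [act act_ok [actA actB act0]] := free_action v.
have [w x wV2|m mS mI] := push_mean (t0 := fp_base _ _) act_ok.
  by apply: act0; apply: contraNneq vV2 => <-.
apply: (no_pingpong (m := m) (act := act) mS act_ok
  (sA := [seq gp_of e x | x <- sA]) (sB := sB)
  (S := [pred y | y.1 != 1]) (Z := predT)) => //.
- by rewrite (mass_T mS).
- by rewrite map_inj_uniq //; exact: gp_of_inj.
- by move=> _ /mapP[x _ ->]; apply: mI; exact: gp_sub_of.
- move=> _ _ /mapP[x _ ->] /mapP[y _ ->] t u _ /negPn/eqP t1 _ /negPn/eqP u1.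
  by rewrite !actA => /(fp_actA_disjoint t1 u1) ->.
- by move=> _ /sB_off [w [x [wV1 _ _ ->]]]; apply: mI; exact: gp_sub_of.
- move=> _ _ /sB_off [w [x [_ wv evw ->]]] /sB_off [z [y [_ zv evz ->]]] t u /=.
  by move=> t1 u1; rewrite !actB //; exact: fp_actB_disjoint.
- by rewrite size_map.
- by rewrite size_map.
Qed.

Section NonEdge.
Hypothesis nontriv : forall v, exists x : G v, x <> 1.
Variables v w : V.
Hypotheses (vP : v \in V1 :\: V2) (wV1 : w \in V1) (vw : v != w).
Hypothesis nadj : ~~ e v w.

Lemma off_star_of x : off_star v (gp_of e (x : G w)).
Proof. by exists w, x; rewrite eq_sym. Qed.

Lemma nonedge_two_elements : two_elements (G v) /\ two_elements (G w).
Proof.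
have [a /eqP aN1] := nontriv v; have [b /eqP bN1] := nontriv w.
split; apply: two_elements_of => //.
- move=> s us; rewrite ltnNge; apply/negP => s3.
  have := @off_star_small v s [:: gp_of e (1 : G w); gp_of e b] vP us.
  rewrite /= inE (inj_eq (@gp_of_inj V e G e_irr w)) eq_sym bN1 => /(_ isT).
  have off : {in [:: gp_of e (1 : G w); gp_of e b], forall g, off_star v g}.
    by move=> g; rewrite !inE => /orP[]/eqP->; exact: off_star_of.
  by move=> /(_ off (ltnW s3) isT); rewrite addn2 !ltnS leqNgt s3.
- move=> s us; rewrite ltnNge; apply/negP => s3.
  have := @off_star_small v [:: 1; a] [seq gp_of e x | x <- s] vP.
  rewrite /= inE eq_sym aN1 map_inj_uniq; last exact: gp_of_inj.
  have off : {in [seq gp_of e x | x <- s], forall g, off_star v g}.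
    by move=> _ /mapP[x _ ->]; exact: off_star_of.
  rewrite us size_map => /(_ isT isT off isT (ltnW s3)).
  by rewrite add2n !ltnS leqNgt s3.
Qed.

Lemma nonedge_adjacent_l u : u \in V1 -> u != v -> u != w -> e v u.
Proof.
move=> uV1 uv uw; apply/negPn/negP => evu.
have [a /eqP aN1] := nontriv v; have [b /eqP bN1] := nontriv w.
have [c /eqP cN1] := nontriv u.
have := @off_star_small v [:: 1; a]
  [:: gp_of e (1 : G w); gp_of e b; gp_of e c] vP.
rewrite /= !inE eq_sym aN1 !negb_or (inj_eq (@gp_of_inj V e G e_irr w)).
rewrite [1 == b]eq_sym bN1 /=.
have -> : gp_of e (1 : G w) != gp_of e c.
  by apply: contraNneq cN1 => /esym/(gp_of_disjoint e_irr uw) ->.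
have -> : gp_of e b != gp_of e c.
  by apply: contraNneq cN1 => /esym/(gp_of_disjoint e_irr uw) ->.
move=> /(_ isT isT) small; suff /small : {in
    [:: gp_of e (1 : G w); gp_of e b; gp_of e c], forall g, off_star v g}.
  by move=> /(_ isT isT).
move=> g; rewrite !inE => /or3P[]/eqP->; try exact: off_star_of.
by exists u, c.
Qed.

Lemma nonedge_adjacent_r u : u \in V1 -> u != v -> u != w -> e w u.
Proof.
move=> uV1 uv uw; apply/negPn/negP => ewu.
have /setDP[vV1 vV2] := vP.
have [vu wu] : v != u /\ w != u by rewrite ![_ == u]eq_sym.
have [act act_ok [actv actw actu act0]] := swap_action vw vu wu nadj ewu.
have [z x zV2|m mS mI] := push_mean (t0 := (1, fp_base _ _)) act_ok.
  by apply: act0; apply: contraNneq vV2 => <-.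
have G2 := nonedge_two_elements.1.
have [a aN1 aP] := G2; have aa := two_elements_sq a G2.
have [b /eqP bN1] := nontriv w; have [d /eqP dN1] := nontriv u.
have Igp z (x : G z) : z \in V1 -> invariants act m (gp_of e x).
  by move=> zV1; apply: mI; exact: gp_sub_of.
pose Z : pred (G v * fp_coset (G w) Gam) := [pred t | t.1 == 1].
pose S : pred (G v * fp_coset (G w) Gam) :=
  [pred t | (t.1 == 1) && (t.2.1 != 1)].
(* The two copies of the cosets are exchanged by [a], so that [Z] has mass at
   least one half. *)
have Z0 : (0 < mass m Z)%R.
  have ZT : subpred Z predT by [].
  have := mass_split mS ZT; rewrite (mass_T mS).
  suff : (mass m [pred t | predT t && ~~ Z t] <= mass m Z)%R by lra.
  apply: (@mass_packing _ _ _ mS _ _ act_ok [:: gp_of e a]) => //.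
  - by move=> g; rewrite inE => /eqP->; exact: Igp.
  - move=> g; rewrite inE => /eqP-> [p y]; rewrite actv /Z /=.
    by case: (aP p) => ->; rewrite ?eqxx ?aa ?eqxx.
  - by move=> g h; rewrite !inE => /eqP-> /eqP->.
(* Inside [Z], the conjugates of [G w] by [a] play against [G u] and [G w]. *)
pose conj (x : G w) := gp_of e a * (gp_of e x * gp_of e a).
have actc x t : Z t -> act (conj x) t = (1, fp_actA x t.2).
  case: t => p y; rewrite /Z /= => /eqP->.
  by rewrite !(actM act_ok) actv actw actv /= mulg1 (negbTE aN1) aa.
pose sB := [:: gp_of e (1 : G w); gp_of e b; gp_of e d].
have actB g t : g \in sB -> Z t -> act g t = (1, fp_actB g t.2).
  case: t => p y gB; rewrite /Z /= => /eqP->.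
  by move: gB; rewrite !inE => /or3P[]/eqP->; rewrite ?actw ?actu //= eqxx.
apply: (no_pingpong (m := m) (act := act) mS act_ok
  (sA := [seq conj x | x <- [:: 1; b]]) (sB := sB) (S := S) (Z := Z)) => //.
- by move=> t /andP[].
- rewrite map_inj_uniq; first by rewrite /= inE eq_sym bN1.
  by move=> x y /mulgI/mulIg/(gp_of_inj e_irr).
- move=> _ /mapP[x _ ->].
  have IM := is_subgroupM (invariants_subgroup act_ok m).
  by apply: (IM); [exact: Igp|apply: IM; exact: Igp].
- by move=> _ /mapP[x _ ->] t Zt _; rewrite actc // /Z /= eqxx.
- move=> _ _ /mapP[x _ ->] /mapP[y _ ->] t t' Zt nSt Zt' nSt'.
  rewrite !actc // => -[xy lt]; congr conj.
  move: Zt Zt' nSt nSt' xy; rewrite /S /Z /= => -> ->.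
  by move=> /negPn/eqP-> /negPn/eqP->; rewrite !mulg1.
- rewrite /= !inE !negb_or (inj_eq (@gp_of_inj V e G e_irr w)).
  rewrite [1 == b]eq_sym bN1.
  apply/andP; split; last rewrite andbT.
    by apply: contraNneq dN1 => /esym/(gp_of_disjoint e_irr uw) ->.
  by apply: contraNneq dN1 => /esym/(gp_of_disjoint e_irr uw) ->.
- by move=> g; rewrite !inE => /or3P[]/eqP->; exact: Igp.
- by move=> g gB t /andP[Zt _]; rewrite actB // /Z /= eqxx.
- move=> g h gB hB t t' /andP[Zt St] /andP[Zt' St'].
  by rewrite !actB // => -[/(fp_actB_disjoint St St')].
Qed.

End NonEdge.

End Obstruction.

(** * Averaging a state over commuting subgroups *)

Section Averaging.
Variables (R : realType) (G : groupType) (X : Type) (act : G -> X -> X).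
Hypothesis act_ok : is_action act.
Local Notation C := R[i].
Variable m : (X -> C) -> C.
Hypothesis m_ok : is_state m.

Lemma average_amenable (P : groupType) (c : {multiplicative P -> G}) :
  amenable R P -> exists2 m' : (X -> C) -> C, is_state m' &
    (forall p, invariants act m' (c p)) /\
    (forall g, (forall p, commute g (c p)) ->
      invariants act m g -> invariants act m' g).
Proof.
move=> [l l_ok l_inv]; exists (average act l c m); first exact: average_state.
split=> [p|g gc]; first exact: average_group.
exact: average_centralizes.
Qed.

(** Two involutions [a] and [b] generate a dihedral group. Averaging first over
    the powers of [t = a * b] and then over [1] and [a] keeps the invariance
    under [t], because [a] inverts [t]. *)
Lemma average_dihedral (a b : G) : a * a = 1 -> b * b = 1 ->
  exists2 m' : (X -> C) -> C, is_state m' &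
    [/\ invariants act m' a, invariants act m' b &
      forall g, commute g a -> commute g b ->
        invariants act m g -> invariants act m' g].
Proof.
move=> aa bb; have aV : a^-1 = a by exact: mulg1_eq.
have bV : b^-1 = b by exact: mulg1_eq.
have [l l_ok l_shift] := banach_limit R.
pose t := a * b; pose m1 := average act l (fun n => t ^+ n) m.
have m1_ok : is_state m1 by exact: average_state.
have m1t : invariants act m1 t.
  rewrite -[t]invgK.
  apply: (is_subgroupV (invariants_subgroup act_ok m1)) => f fB.
  rewrite /m1 /average -[RHS]l_shift; last first.
    exact: (@bounded_translates _ _ _ act _ (fun n => t ^+ n) _ m_ok _ fB).
  congr l; apply/funext => n; congr m; apply/funext => x.
  by rewrite invgK -(actM act_ok) -expgS.
pose l2 (f : bool -> C) : C := ((f true + f false) / 2)%R.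
have l2_ok : is_state l2.
  rewrite /l2; split=> [k f g _ _|f _ f0|].
  - by rewrite mulrDl !mulrDl addrACA -!mulrA -mulrDr.
  - by rewrite divr_ge0 // addr_ge0.
  - by rewrite -mulr2n divff // pnatr_eq0.
pose c (i : bool) := if i then a else 1.
exists (average act l2 c m1); first exact: average_state.
have m2a : invariants act (average act l2 c m1) a.
  move=> f fB; rewrite /average /l2 /c aV addrC.
  congr ((m1 _ + m1 _) / 2)%R; apply/funext => x.
    by rewrite (act1 act_ok).
  by rewrite -(actM act_ok) aa.
have m2t : invariants act (average act l2 c m1) t.
  apply: average_normalizes => // -[] /=; last by rewrite invg1 mul1g mulg1.
  rewrite /t aV !mulgA aa mul1g -[b * a]invgK invgM aV bV.
  exact: (is_subgroupV (invariants_subgroup act_ok m1)).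
split=> //.
  rewrite -[b]mul1g -aa -mulgA.
  exact: (is_subgroupM (invariants_subgroup act_ok _)).
move=> g ga gb mg; apply: average_centralizes => //.
  by case=> //; exact: commute1.
apply: average_centralizes => // n.
by apply/commuteX/commuteM.
Qed.

End Averaging.

(** * Sufficiency *)

Section CosetAction.
Variables (G : groupType) (L : set G).

Lemma left_coset_mul_action : is_action (@left_coset_mul G L).
Proof.
split=> [[D DP]|x y [D DP]]; apply: val_inj => /=; apply/seteqP.
  by split=> [_ [z Dz <-]|z Dz]; [rewrite mul1g|exists z; rewrite ?mul1g].
split=> [_ [z Dz <-]|_ [_ [z Dz <-] <-]]; last by exists z; rewrite ?mulgA.
by exists (y * z); [exists z|rewrite mulgA].
Qed.

Hypothesis L_sub : is_subgroup L.

Lemma base_cosetP : [set 1 * h | h in L]%classic \in left_cosets L.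
Proof. by apply/mem_set; exists 1. Qed.

Definition base_coset : left_cosets L := SigSub base_cosetP.

Lemma base_coset_fix h : L h -> left_coset_mul h base_coset = base_coset.
Proof.
move=> Lh; have LM := is_subgroupM L_sub; have LV := is_subgroupV L_sub.
apply: val_inj => /=; apply/seteqP.
split=> [_ [_ [k Lk <-] <-]|_ [k Lk <-]].
  by exists (h * k); [exact: LM|rewrite !mul1g].
exists (h^-1 * k); last by rewrite mul1g mulVKg.
by exists (h^-1 * k); [apply: LM => //; exact: LV|rewrite mul1g].
Qed.

Lemma dirac_state (R : realType) (X : Type) (x : X) :
  is_state (fun f : X -> R[i] => f x).
Proof. by split=> // f _; apply. Qed.

End CosetAction.

Section Sufficiency.
Variables (R : realType) (V : finType) (e : rel V) (G : V -> groupType).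
Hypothesis e_sym : symmetric e.
Variables V1 V2 : {set V}.
Local Notation Gam := (graph_product e G).
Local Notation C := R[i].
Local Notation cosets := (left_cosets (gp_sub e G V2)).
Local Notation act := (@left_coset_mul _ (gp_sub e G V2)).

Hypothesis amen : forall v, v \in V1 :\: V2 -> amenable R (G v).
Hypothesis pairs : forall v w, v \in V1 :\: V2 -> w \in V1 -> v <> w ->
  e v w \/ (two_elements (G v) /\ two_elements (G w)) /\
    (forall u, u \in V1 :\: [set v; w] -> e v u /\ e w u).

Definition vertex_invariant (m : (cosets -> C) -> C) v :=
  forall x : G v, invariants act m (gp_of e x).

(** If [v] has a non-neighbour [w] in [V1], the invariance under [G w] is lost
    in the average over [G v] alone, and the dihedral average restores it. *)
Lemma average_vertex v (m : (cosets -> C) -> C) :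
  v \in V1 :\: V2 -> is_state m ->
  exists2 m' : (cosets -> C) -> C, is_state m' & vertex_invariant m' v /\
    forall u, u \in V1 -> vertex_invariant m u -> vertex_invariant m' u.
Proof.
move=> vP mS; have act_ok := left_coset_mul_action (gp_sub e G V2).
have inv2 m' (w : V) (b : G w) : (forall x, x = 1 \/ x = b) ->
    invariants act m' (gp_of e b) -> vertex_invariant m' w.
  move=> bP mb x; case: (bP x) => -> //.
  rewrite (group_morph1 (@gp_of V e G w)).
  by case: (invariants_subgroup act_ok m').
case: (pickP [pred w | [&& w \in V1, w != v & ~~ e v w]]) =>
    [w /and3P[wV1 wv evw]|adj].
  have vw : v <> w by apply/eqP; rewrite eq_sym.
  have [evw'|[[Gv2 Gw2] adj]] := pairs vP wV1 vw; first by rewrite evw' in evw.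
  have [a _ aP] := Gv2; have [b _ bP] := Gw2.
  have sq z (x : G z) : two_elements (G z) -> gp_of e x * gp_of e x = 1.
    move=> Gz2; rewrite -gp_ofM two_elements_sq //.
    exact: (group_morph1 (@gp_of V e G z)).
  have [m' m'S [m'a m'b m'g]] :=
    average_dihedral act_ok mS (sq v a Gv2) (sq w b Gw2).
  exists m' => //; split=> [|u uV1 mu]; first exact: inv2 m'a.
  have [->|uv] := eqVneq u v; first exact: inv2 m'a.
  have [->|uw] := eqVneq u w; first exact: inv2 m'b.
  have [evu ewu] : e v u /\ e w u by apply: adj; rewrite !inE negb_or uv uw.
  by move=> x; apply: m'g => //; apply: gp_of_comm; rewrite e_sym.
have [m' m'S [m'v m'g]] :=
  average_amenable act_ok mS (@gp_of V e G v) (amen vP).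
exists m' => //; split=> // u uV1 mu.
have [->//|uv x] := eqVneq u v.
apply: m'g => // p; apply: gp_of_comm; rewrite e_sym.
by have := adj u; rewrite /= uV1 uv /= => /negbFE.
Qed.

Lemma rel_amenable_of_pairs : rel_amenable R (gp_sub e G V1) (gp_sub e G V2).
Proof.
have act_ok := left_coset_mul_action (gp_sub e G V2).
have [m mS mI] : exists2 m : (cosets -> C) -> C, is_state m &
    forall v, v \in V1 -> (v \in V2) || (v \in enum (V1 :\: V2)) ->
      vertex_invariant m v.
  have : {subset enum (V1 :\: V2) <= V1 :\: V2} by move=> v; rewrite mem_enum.
  elim: (enum _) => [_|v s IHs sub].
    exists (fun f => f (base_coset (gp_sub e G V2))); first exact: dirac_state.
    move=> v _; rewrite orbF => vV2 x f _; congr f.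
    apply: base_coset_fix; first exact: gp_sub_subgroup.
    by rewrite -(group_morphV (@gp_of V e G v)); exact: gp_sub_of.
  have [|m mS mI] := IHs; first by move=> u us; apply: sub; rewrite inE us orbT.
  have [|m' m'S [m'v m'I]] := @average_vertex v m _ mS.
    by apply: sub; rewrite mem_head.
  exists m' => // u uV1; rewrite inE orbCA => /predU1P[->//|us].
  by apply: m'I => //; exact: mI.
exists m => // s; move: s; apply: (gp_sub_min (P := invariants act m)).
  exact: invariants_subgroup.
move=> v x vV1; apply: mI => //.
by rewrite mem_enum inE vV1 andbT orbN.
Qed.

End Sufficiency.

Theorem corollary2 (R : realType) (V : finType) (e : rel V)
    (he_sym : symmetric e) (he_irr : irreflexive e)
    (G : V -> groupType) (hG : forall v, exists x : G v, x <> 1)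
    (V1 V2 : {set V}) :
  rel_amenable R (gp_sub e G V1) (gp_sub e G V2) <->
  (forall v, v \in V1 :\: V2 -> amenable R (G v)) /\
  (forall v w, v \in V1 :\: V2 -> w \in V1 -> v <> w ->
     e v w \/
     (group_isog (G v) 'Z_2 /\ group_isog (G w) 'Z_2) /\
     (forall u, u \in V1 :\: [set v; w] -> e v u /\ e w u)).
Proof.
split=> [V12|[amen pairs]].
  split=> [v|v w vP wV1 /eqP vw]; first exact: (amenable_vertex he_irr V12).
  case: (boolP (e v w)) => [|evw]; [by left|right].
  split.
    rewrite !two_elements_isogP.
    exact: (nonedge_two_elements he_irr he_sym V12 hG vP wV1 vw evw).
  move=> u; rewrite !inE negb_or => /andP[/andP[uv uw] uV1]; split.
    exact: (nonedge_adjacent_l he_irr he_sym V12 hG vP wV1 vw evw).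
  exact: (nonedge_adjacent_r he_irr he_sym V12 hG vP wV1 vw evw).
apply: rel_amenable_of_pairs => // v w vP wV1 vw.
by have := pairs v w vP wV1 vw; rewrite !two_elements_isogP.
Qed.
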